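(* An analytic P-ideal on $\omega$ is totally bounded if and only if it has the Local-to-Global Boundedness Property for submeasures.
   Context: Ideals on $\omega$ are proper and contain all finite sets; analytic means analytic as a subset of $2^\omega$ (identifying sets with characteristic functions); a P-ideal $\mathcal{I}$ is one such that for every sequence $(A_n)$ in $\mathcal{I}$ there is $A\in\mathcal{I}$ with $A_n\setminus A$ finite for all $n$. A submeasure on $\omega$ is $\varphi\colon\wp(\omega)\to[0,\infty]$ with $\varphi(\emptyset)=0$, $\varphi(\{n\})<\infty$, monotone and subadditive; lower semicontinuous (lsc) if $\varphi(A)=\lim_n\varphi(A\cap[0,n])$. $\mathrm{fin}(\varphi)=\{A\colon\varphi(A)<\infty\}$, $\mathrm{exh}(\varphi)=\{A\colon\lim_n\varphi(A\setminus[0,n])=0\}$. An analytic P-ideal $\mathcal{I}$ is totally bounded if $\varphi(\omega)<\infty$ whenever $\varphi$ is an lsc submeasure with $\mathcal{I}=\mathrm{exh}(\varphi)$. An ideal $\mathcal{I}$ has the Local-to-Global Boundedness Property for submeasures if $\varphi(\omega)<\infty$ whenever $\varphi$ is an lsc submeasure with $\mathcal{I}\subseteq\mathrm{fin}(\varphi)$. *)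

(* Defs.v *)
From HB Require Import structures.
From mathcomp Require Import all_boot all_order all_algebra.
From mathcomp Require Import all_classical all_reals all_analysis.

Set Implicit Arguments.
Unset Strict Implicit.
Unset Printing Implicit Defensive.

Import Order.TTheory GRing.Theory Num.Theory.
Import numFieldNormedType.Exports.

Local Open Scope classical_set_scope.
Local Open Scope ring_scope.
Local Open Scope ereal_scope.

Definition baire_space : topologicalType := prod_topology (fun _ : nat => nat).

Definition analytic (X : topologicalType) (B : set X) : Prop :=
  B = set0 \/ exists2 f : baire_space -> X, continuous f & B = range f.

Definition charfun (A : set nat) : cantor_space := fun n => `[< A n >].

Record is_ideal (I : set (set nat)) : Prop := IsIdeal {
  ideal_proper : ~ I setT;
  ideal_finite : forall A, finite_set A -> I A;
  ideal_subset : forall A B, A `<=` B -> I B -> I A;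
  ideal_setU : forall A B, I A -> I B -> I (A `|` B) }.

Definition analytic_ideal (I : set (set nat)) : Prop :=
  analytic (charfun @` I).

Definition P_ideal (I : set (set nat)) : Prop :=
  forall A_ : nat -> set nat, (forall n, I (A_ n)) ->
  exists2 A, I A & forall n, finite_set (A_ n `\` A).

Section submeasure.
Variable R : realType.
Implicit Types phi : set nat -> \bar R.

Record is_submeasure phi : Prop := IsSubmeasure {
  submeasure_ge0 : forall A, 0 <= phi A;
  submeasure0 : phi set0 = 0;
  submeasure1_lty : forall n, phi [set n] < +oo;
  submeasure_le : forall A B, A `<=` B -> phi A <= phi B;
  submeasureU : forall A B, phi (A `|` B) <= phi A + phi B }.

(* `I_n.+1 is the initial segment [0, n]. *)
Definition lsc phi : Prop :=
  forall A, phi (A `&` `I_n.+1) @[n --> \oo] --> phi A.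

Definition lsc_submeasure phi : Prop := is_submeasure phi /\ lsc phi.

Definition fin phi : set (set nat) := [set A | phi A < +oo].

Definition exh phi : set (set nat) :=
  [set A | phi (A `\` `I_n.+1) @[n --> \oo] --> 0].

Definition totally_bounded (I : set (set nat)) : Prop :=
  forall phi, lsc_submeasure phi -> I = exh phi -> phi setT < +oo.

Definition local_to_global_boundedness (I : set (set nat)) : Prop :=
  forall phi, lsc_submeasure phi -> I `<=` fin phi -> phi setT < +oo.

End submeasure.

(* Main.v *)
Require Import Defs.
From mathcomp Require Import all_boot all_order all_algebra.
From mathcomp Require Import all_classical all_reals all_analysis.
From mathcomp Require Import lra.

(** An lsc submeasure is finite on every member of its exhaustive ideal, so
    local-to-global boundedness implies total boundedness. Conversely, given
    an lsc [phi] with [I `<=` fin phi], we construct an lsc [chi] with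
    [I = exh chi] and [fin chi `<=` fin phi]; total boundedness of [I] then
    yields [chi setT < +oo], hence [phi setT < +oo].

    Call a closed hereditary family of sets large if it contains a tail of
    every member of [I]. Parametrize [I] continuously by the Baire space.
    Since [I] is a P-ideal, a family covering [I] by countably many pieces has
    a piece that is cofinal modulo finite sets, so on some nonempty closed set
    [D] of parameters every cylinder has cofinal image. The closures of the
    hereditary hulls of these images form a countable collection of large
    families, and a set belongs to [I] as soon as each of them contains one of
    its tails. A Baire category argument on [D] x [D] shows that every large
    family [F] admits a large [F'] such that the unions of two members of [F']
    lie in [F]. Since [I] is a P-ideal, some sublevel set [phi <= N] is large.
    Starting there one gets families [G k] indexed by the integers, sublevel
    sets of [phi] for [k >= 0] and large families shrinking to [I] for [k < 0],
    such that unions of three members of [G k] lie in [G (k + 1)]; [chi] is the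
    submeasure obtained by charging [2 ^ k] for covering by a member of
    [G k]. *)

Set Implicit Arguments.
Unset Strict Implicit.
Unset Printing Implicit Defensive.

Import Order.TTheory GRing.Theory Num.Theory.

Local Open Scope classical_set_scope.


Definition agree k (x y : nat -> nat) := forall i, i < k -> x i = y i.

Lemma agree_sym k x y : agree k x y -> agree k y x.
Proof. by move=> xy i ik; rewrite xy. Qed.

Lemma agree_trans k x y z : agree k x y -> agree k y z -> agree k x z.
Proof. by move=> xy yz i ik; rewrite xy // yz. Qed.

Lemma agree_leq k l x y : k <= l -> agree l x y -> agree k x y.
Proof. by move=> kl xy i ik; apply/xy/(leq_trans ik). Qed.

Lemma agree_limit (u : nat -> nat -> nat) (k : nat -> nat) :
  (forall n, k n < k n.+1) -> (forall n, agree (k n) (u n) (u n.+1)) ->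
  exists v, forall n, agree (k n) (u n) v.
Proof.
move=> kS uS.
have k_ge n : n <= k n by elim: n => // n /leq_ltn_trans; apply.
have kD m n : k m <= k (m + n).
  by elim: n => [|n IH]; rewrite ?addn0 // addnS (leq_trans IH) // ltnW.
have uD m n : agree (k m) (u m) (u (m + n)).
  elim: n => [|n IH]; first by rewrite addn0.
  by apply: (agree_trans IH); rewrite addnS; apply: agree_leq (uS _); exact: kD.
(* Coordinate [i] is settled from stage [i.+1] on, because [k i.+1] exceeds [i]. *)
exists (fun i => u i.+1 i) => n i ik.
by case/orP: (leq_total n i.+1) => [/subnKC <-|/subnKC nE];
  [exact: uD | rewrite -nE (uD i.+1 (n - i.+1)) // k_ge].
Qed.

Lemma nbhs_agree (x : baire_space) (U : set baire_space) :
  nbhs x U -> exists k, agree k x `<=` U.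
Proof.
pose F : set_system baire_space := filter_from [set: nat] (fun k => agree k x).
have FF : Filter F.
  apply: filter_from_filter; first by exists 0.
  move=> i j _ _; exists (maxn i j) => // y xy.
  by split; apply: agree_leq xy; rewrite ?leq_maxl ?leq_maxr.
have : F --> x.
  apply/(@pointwise_cvgP nat nat F x FF) => t V /nbhs_singleton Vx.
  by exists t.+1 => // y xy /=; rewrite -xy.
by move=> /[apply] -[k _ kU]; exists k.
Qed.

Lemma continuous_agree (f : baire_space -> cantor_space) (x : baire_space) n :
  continuous f -> exists k, forall y, agree k x y ->
    forall i, i < n -> f y i = f x i.
Proof.
move=> cf; elim: n => [|n [k kP]]; first by exists 0.
have /nbhs_agree[l lP] : nbhs x [set y : baire_space | f y n = f x n].
  have : continuous (proj n \o f : baire_space -> bool).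
    move=> y; apply: continuous_comp; first exact: cf.
    exact: (@proj_continuous nat (fun=> bool) n).
  by move=> /(_ x [set b | b = f x n]); apply; exact: (@discrete_set1 bool).
exists (maxn k l) => y xy i.
rewrite ltnS leq_eqVlt => /orP[/eqP ->|]; last first.
  by apply: kP; apply: agree_leq xy; exact: leq_maxl.
by apply: lP; apply: agree_leq xy; exact: leq_maxr.
Qed.

(** * Cofinal parametrizations of analytic P-ideals *)

Lemma finite_set_bounded (A : set nat) :
  finite_set A -> exists m, A `<=` `I_m.
Proof.
move=> /finite_seqP[s ->]; exists (\max_(i <- s) i).+1 => i /= si.
by rewrite ltnS; apply: (@leq_bigmax_seq _ _ _ id).
Qed.

Definition cofinal (I : set (set nat)) (g : (nat -> nat) -> set nat)
    (E : set (nat -> nat)) :=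
  forall A, I A -> exists2 y, E y & finite_set (A `\` g y).

(* [g] is a continuous parametrization, by the closed set [D] of the Baire
   space, of a family in [I] such that the sets coming from any relatively open
   part of [D] are cofinal in [I] modulo finite sets. *)
Record cofinal_scheme (I : set (set nat)) (g : (nat -> nat) -> set nat)
    (D : set (nat -> nat)) : Prop := CofinalScheme {
  scheme_ideal : forall x, I (g x);
  scheme_continuous : forall x n, exists k, forall y, agree k x y ->
    g y `&` `I_n = g x `&` `I_n;
  scheme_closed : forall x, (forall k, exists2 y, D y & agree k x y) -> D x;
  scheme_neq0 : D !=set0;
  scheme_cofinal : forall x k, D x -> cofinal I g (agree k x `&` D) }.

(** If every piece [E n] misses some [A n], a pseudo-union [B] of the [A n] is almost covered by
    some [g y]. The piece containing [y] then does not miss its own [A n]. *)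
Lemma cofinal_bigcup I g (E : nat -> set (nat -> nat)) : P_ideal I ->
  cofinal I g (\bigcup_n E n) -> exists n, cofinal I g (E n).
Proof.
move=> PI cE; apply: contrapT => /forallNP nE.
have /choice[A AP] : forall n, exists A,
    I A /\ forall y, E n y -> ~ finite_set (A `\` g y).
  move=> n; have /existsNP[A /not_implyP[IA nA]] := nE n.
  by exists A; split=> // y Ey fA; apply: nA; exists y.
have [B IB AB] := PI A (fun n => (AP n).1).
have [y [n _ Ey] By] := cE B IB.
apply: ((AP n).2 y Ey).
apply: (@sub_finite_set _ _ ((A n `\` B) `|` (B `\` g y))).
  by move=> i [Ai gi]; have [Bi|nBi] := pselect (B i); [right|left].
by rewrite finite_setU.
Qed.

(** [D] is what remains after deleting the countably many cylinders with non-cofinal image; the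
    deletion preserves cofinality. *)
Lemma analytic_P_ideal_scheme I : is_ideal I -> analytic_ideal I ->
  P_ideal I -> exists g D, cofinal_scheme I g D.
Proof.
move=> idI [I0|[f cf If]] PI.
  have : (charfun @` I) (charfun set0).
    by exists set0 => //; apply: (ideal_finite idI).
  by rewrite I0.
pose g x : set nat := [set n | f x n].
have charfunK A : [set n | charfun A n] = A.
  by apply/seteqP; split=> n; rewrite /charfun /= => /asboolP.
have Ig x : I (g x).
  have : (charfun @` I) (f x) by rewrite If; exists x.
  by move=> [A IA fA]; rewrite /g -fA charfunK.
have gI A : I A -> exists x, g x = A.
  move=> IA; have : (charfun @` I) (charfun A) by exists A.
  by rewrite If => -[x _ fx]; exists x; rewrite /g fx charfunK.
pose D : set (nat -> nat) := [set x | forall k, cofinal I g (agree k x)].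
have cofD E : cofinal I g E -> cofinal I g (E `&` D).
  (* The pieces [En] are [E] restricted to [D] together with all non-cofinal cylinders. They cover
     [E], so one of them is cofinal, and only the first kind can be. *)
  move=> cE; pose N (s : seq nat) : set (nat -> nat) := agree (size s) (nth 0 s).
  pose En n := if unpickle n is Some s then
    if `[< cofinal I g (N s) >] then E `&` D else N s else E `&` D.
  have [] := @cofinal_bigcup I g En PI.
    move=> A /cE[y Ey fy]; exists y => //.
    have [Dy|/existsNP[k nk]] := pselect (D y).
      exists (pickle ([::] : seq nat)) => //.
      by rewrite /En pickleK; case: asboolP.
    have Nk : N (mkseq y k) = agree k y.
      by apply/seteqP; split=> z yz i; have := yz i; rewrite size_mkseq =>
        + ik => /(_ ik); rewrite nth_mkseq.
    exists (pickle (mkseq y k)) => //; rewrite /En pickleK Nk.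
    by case: asboolP.
  by move=> n; rewrite /En; case: unpickle => [s|] //; case: asboolP.
have cT : cofinal I g setT.
  by move=> A /gI[x <-]; exists x => //; rewrite setDv.
exists g, D; split=> //.
- move=> x n; have [k kP] := continuous_agree x n cf; exists k => y /kP fy.
  by apply/seteqP; split=> i [gi /= ilt]; split=> //; move: gi; rewrite /g /= fy.
- move=> x xD k A /=; have [y Dy xy] := xD k; move=> /(Dy k)[z yz fz].
  by exists z => //; exact: agree_trans yz.
- have [y [_ Dy] _] := cofD _ cT set0 (ideal_finite idI (finite_set0 _)).
  by exists y.
- by move=> x k Dx; apply: cofD.
Qed.

(** * Large families *)

(* The first two fields say that [F] is a hereditary closed subset of the Cantor
   space. *)
Record large_family (I F : set (set nat)) : Prop := LargeFamily {
  large_subset : forall A B, A `<=` B -> F B -> F A;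
  large_closed : forall A, (forall n, F (A `&` `I_n)) -> F A;
  large_tail : forall A, I A -> exists m, F (A `\` `I_m) }.

Lemma large_familyI I F1 F2 :
  large_family I F1 -> large_family I F2 -> large_family I (F1 `&` F2).
Proof.
move=> l1 l2; split.
- move=> A B AB [F1B F2B].
  by split; [exact: (large_subset l1 AB) | exact: (large_subset l2 AB)].
- move=> A FA; split.
    by apply: (large_closed l1) => n; have [] := FA n.
  by apply: (large_closed l2) => n; have [] := FA n.
- move=> A IA; have [m1 F1A] := large_tail l1 IA.
  have [m2 F2A] := large_tail l2 IA.
  exists (maxn m1 m2); split.
    apply: (large_subset l1 _ F1A) => i [Ai im]; split=> // im1; apply: im => /=.
    by rewrite leq_max im1.
  apply: (large_subset l2 _ F2A) => i [Ai im]; split=> // im1; apply: im => /=.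
  by rewrite leq_max im1 orbT.
Qed.

Lemma large_family_tail I F m :
  large_family I F -> large_family I [set A | F A /\ A `&` `I_m = set0].
Proof.
move=> lF; apply: (@large_familyI _ _ [set A | A `&` `I_m = set0]) => //; split.
- move=> A B AB /= B0; rewrite -subset0 -B0; exact: setSI.
- move=> A /= A0; rewrite -subset0 => i [Ai im].
  by rewrite -(A0 i.+1); split=> //=; split=> /=.
- by move=> A _; exists m; rewrite /= -subset0 => i [[]].
Qed.

(** * Unions of members of large families, and recovery of the ideal from its cylinders *)

Section scheme.
Variables (I : set (set nat)) (g : (nat -> nat) -> set nat).
Variable D : set (nat -> nat).
Hypothesis sD : cofinal_scheme I g D.

Lemma scheme_limit (u : nat -> nat -> nat) (k : nat -> nat) :
  (forall n, D (u n)) -> (forall n, k n < k n.+1) ->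
  (forall n, agree (k n) (u n) (u n.+1)) ->
  exists2 v, D v & forall n, agree (k n) (u n) v.
Proof.
move=> Du kS uS; have [v uv] := agree_limit kS uS; exists v => //.
apply: (scheme_closed sD) => n; exists (u n) => //; apply: agree_sym.
apply: agree_leq (uv n); elim: n => // n /leq_ltn_trans; apply; exact: kS.
Qed.

(* The closure in the Cantor space of the subsets of the [g y], for [y] in [D]
   with the prescribed first [k] values. *)
Definition cylinder_family (x : nat -> nat) k : set (set nat) :=
  [set A | forall n, exists y, [/\ D y, agree k x y & A `&` `I_n `<=` g y]].

Lemma cylinder_family_large x k : D x -> large_family I (cylinder_family x k).
Proof.
move=> Dx; split.
- move=> A B AB FB n; have [y [Dy xy By]] := FB n; exists y; split=> //.
  by apply: subset_trans By; exact: setSI.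
- move=> A FA n; have [y [Dy xy By]] := FA n n; exists y; split=> //.
  by move: By; rewrite -setIA setIid.
- move=> A /(scheme_cofinal sD k Dx)[y [xy Dy] /finite_set_bounded[m mP]].
  exists m => n; exists y; split=> // i [[Ai im] _].
  by apply: contrapT => gi; apply: im; apply: mP.
Qed.

(** The strict bound [l < k] makes cylinder lengths grow in the recursive constructions below. *)
Lemma scheme_continuous_pair x y n l : exists2 k, l < k &
  forall x' y', agree k x x' -> agree k y y' ->
    g x' `&` `I_n = g x `&` `I_n /\ g y' `&` `I_n = g y `&` `I_n.
Proof.
have [k1 k1P] := scheme_continuous sD x n.
have [k2 k2P] := scheme_continuous sD y n.
exists (maxn l.+1 (maxn k1 k2)); first by rewrite leq_max leqnn.
move=> x' y' xx' yy'; split; [apply: k1P | apply: k2P].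
  by apply: agree_leq xx'; rewrite !leq_max leqnn !orbT.
by apply: agree_leq yy'; rewrite !leq_max leqnn !orbT.
Qed.

(* A Baire category argument: otherwise one finds [x] and [y] in [D] no tail of
   whose union [g x `|` g y] belongs to [F]. *)
Lemma large_cylinders F : is_ideal I -> large_family I F ->
  exists x y k m, [/\ D x, D y & forall x' y', D x' -> D y' ->
    agree k x x' -> agree k y y' -> F ((g x' `|` g y') `\` `I_m)].
Proof.
move=> idI lF; apply: contrapT => noF.
pose st := ((nat -> nat) * (nat -> nat) * nat)%type.
pose ok (s : st) := D s.1.1 /\ D s.1.2.
have /choice[next nextP] : forall sm : st * nat, exists t : st, ok sm.1 ->
    [/\ ok t, agree sm.1.2 sm.1.1.1 t.1.1, agree sm.1.2 sm.1.1.2 t.1.2,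
    sm.1.2 < t.2 & forall x y, agree t.2 t.1.1 x -> agree t.2 t.1.2 y ->
      ~ F ((g x `|` g y) `\` `I_(sm.2))].
  move=> [[[x y] k] m] /=; rewrite /ok /=.
  have [[Dx Dy]|?] := pselect (D x /\ D y); last by exists (x, y, k).
  have [x' [y' [Dx' Dy' xx' yy' nF]]] : exists x' y', [/\ D x', D y',
      agree k x x', agree k y y' & ~ F ((g x' `|` g y') `\` `I_m)].
    apply: contrapT => nF; apply: noF; exists x, y, k, m; split=> // x' y' *.
    by apply: contrapT => ?; apply: nF; exists x', y'.
  (* Closedness of [F] lets a finite segment witness the failure, and continuity of [g] keeps that
     segment on a whole pair of cylinders. *)
  have [n nFn] : exists n, ~ F (((g x' `|` g y') `\` `I_m) `&` `I_n).
    apply: contrapT => /forallNP FF; apply: nF; apply: (large_closed lF) => n.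
    exact: contrapT (FF n).
  have [l kl lP] := scheme_continuous_pair x' y' n k.
  exists (x', y', l) => _; split=> //= x'' y'' /lP{lP}lP /lP[gx gy] Fxy.
  apply: nFn; apply: (large_subset lF _ Fxy) => i [[[gi|gi] im] iln].
    have : (g x' `&` `I_n) i by [].
    by rewrite -gx => -[? _]; split=> //; left.
  have : (g y' `&` `I_n) i by [].
  by rewrite -gy => -[? _]; split=> //; right.
have [x0 Dx0] := scheme_neq0 sD.
pose s := fix s n : st := if n is m.+1 then next (s m, m) else (x0, x0, 0).
have sok n : ok (s n).
  by elim: n => [//|n IH]; have [] := nextP (s n, n) IH.
have sP n := nextP (s n, n) (sok n).
have kS n : (s n).2 < (s n.+1).2 by have [] := sP n.
have [x Dx xP] : exists2 v, D v & forall n, agree (s n).2 (s n).1.1 v.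
  apply: scheme_limit => [n|//|n]; first by have [] := sok n.
  by have [] := sP n.
have [y Dy yP] : exists2 v, D v & forall n, agree (s n).2 (s n).1.2 v.
  apply: scheme_limit => [n|//|n]; first by have [] := sok n.
  by have [] := sP n.
(* Largeness puts the tail beyond some [m] into [F], which stage [m] of the construction forbids. *)
have /(large_tail lF)[m mP] : I (g x `|` g y).
  by apply: (ideal_setU idI); exact: (scheme_ideal sD).
by have [_ _ _ _] := sP m; apply; [exact: (xP m.+1)|exact: (yP m.+1)|exact: mP].
Qed.

(** Intersecting the two cylinder families lets [A] be controlled by the first cylinder and [B] by
    the second; discarding sets that meet [I_m] absorbs the tail. *)
Lemma large_family_half F : is_ideal I -> large_family I F ->
  exists2 F', large_family I F' & forall A B, F' A -> F' B -> F (A `|` B).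
Proof.
move=> idI lF; have [x [y [k [m [Dx Dy xyF]]]]] := large_cylinders idI lF.
exists [set A | (cylinder_family x k `&` cylinder_family y k) A /\
    A `&` `I_m = set0].
  apply: large_family_tail.
  by apply: large_familyI; exact: cylinder_family_large.
move=> A B [[FA _] A0] [[_ FB] B0]; apply: (large_closed lF) => n.
have [x' [Dx' xx' Ax']] := FA n; have [y' [Dy' yy' By']] := FB n.
apply: (large_subset lF _ (xyF x' y' Dx' Dy' xx' yy')) => i [ABi iln].
split; last first.
  move=> im; case: ABi => [Ai|Bi].
    by have : (A `&` `I_m) i by []; rewrite A0.
  by have : (B `&` `I_m) i by []; rewrite B0.
by case: ABi => [Ai|Bi]; [left; apply: Ax' | right; apply: By'].
Qed.

Lemma large_family_third F : is_ideal I -> large_family I F ->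
  exists2 F', large_family I F' &
    forall A B C, F' A -> F' B -> F' C -> F (A `|` B `|` C).
Proof.
move=> idI lF; have [F1 lF1 F1P] := large_family_half idI lF.
have [F2 lF2 F2P] := large_family_half idI lF1; exists F2 => // A B C FA FB FC.
by apply: F1P; [exact: F2P | rewrite -(setUid C); exact: F2P].
Qed.

(* The points [x] and [y] with [A `\` `I_m `<=` g x `|` g y] are built
   alternately: while the next cylinder around one of them is being chosen, the
   part of [A] that it will not control is covered by the other. *)
Lemma cylinder_families_ideal A : is_ideal I ->
  (forall x k, D x -> exists m, cylinder_family x k (A `\` `I_m)) -> I A.
Proof.
move=> idI AF.
pose pt := ((nat -> nat) * nat)%type.
(* A state holds two cylinders and a bound. The family of the first cylinder contains the tail of
   [A] beyond the bound; its point is refined next, and then the two cylinders swap places. *)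
pose st := (pt * pt * nat)%type.
pose ok (s : st) := [/\ D s.1.1.1, D s.1.2.1 &
  cylinder_family s.1.1.1 s.1.1.2 (A `\` `I_(s.2))].
have /choice[next nextP] : forall s : st, exists t : st, ok s ->
    [/\ ok t, t.1.1 = s.1.2,
      agree s.1.1.2 s.1.1.1 t.1.2.1 /\ s.1.1.2 < t.1.2.2, s.2 < t.2 &
      forall z, agree t.1.2.2 t.1.2.1 z ->
        (A `\` `I_(s.2)) `&` `I_(t.2) `<=` g z].
  move=> [[[x k] [y l]] m]; rewrite /ok /=.
  set P := [/\ _, _ & _]; have [[Dx Dy FA]|?] := pselect P; last first.
    by exists (x, k, (y, l), m).
  have [n nFA] := AF y l Dy; pose n' := maxn m.+1 n.
  have [x' [Dx' xx' Ax']] := FA n'.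
  have [k' kk' k'P] := scheme_continuous_pair x' x' n' k.
  exists (y, l, (x', k'), n') => _; split=> //=.
  - split=> //; apply: (large_subset (cylinder_family_large l Dy) _ nFA).
    move=> i [Ai im]; split=> // /= iln; apply: im => /=.
    by rewrite leq_max iln orbT.
  - by rewrite leq_max leqnn.
  - move=> z xz i Ai; have [gz _] := k'P _ _ xz xz.
    have : (g x' `&` `I_n') i by split; [exact: Ax' | case: Ai].
    by rewrite -gz => -[].
have [x0 Dx0] := scheme_neq0 sD.
have [m0 m0P] := AF x0 0 Dx0.
pose s := fix s n : st :=
  if n is m.+1 then next (s m) else (x0, 0, (x0, 0), m0).
have sok n : ok (s n).
  by elim: n => [//|n IH]; have [] := nextP (s n) IH.
have sP n := nextP (s n) (sok n).
have s2 n : (s n.+2).1.1 = (s n.+1).1.2 by have [_] := sP n.+1.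
(* Because of the swaps, refinements of the same point come first in every second state; the parity
   of [i] selects the point. *)
have lim i : exists2 v, D v &
    forall n, agree (s (i + n.*2).+2.+1).1.1.2 (s (i + n.*2).+2.+1).1.1.1 v.
  apply: (@scheme_limit (fun n => (s (i + n.*2).+2.+1).1.1.1)
    (fun n => (s (i + n.*2).+2.+1).1.1.2)) => n.
  - by have [] := sok (i + n.*2).+2.+1.
  - rewrite doubleS !addnS (s2 (i + n.*2).+3).
    by have [_ _ []] := sP (i + n.*2).+3.
  - rewrite doubleS !addnS (s2 (i + n.*2).+3).
    by have [_ _ []] := sP (i + n.*2).+3.
have [x Dx xP] := lim 0; have [y Dy yP] := lim 1.
have m_ge n : n <= (s n).2.
  elim: n => // n IH; have [_ _ _ mm _] := sP n; exact: leq_ltn_trans mm.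
suff AD : A `\` `I_(s 1).2 `<=` g x `|` g y.
  apply: (ideal_subset idI (B := `I_(s 1).2 `|` (g x `|` g y))).
    move=> i Ai; have [?|?] := pselect (`I_(s 1).2 i); first by left.
    by right; apply: AD.
  apply: (ideal_setU idI); first exact/(ideal_finite idI)/finite_II.
  by apply: (ideal_setU idI); exact: (scheme_ideal sD).
have AS n : A `&` `I_(s n.+1).2 `\` `I_(s 1).2 `<=` g x `|` g y.
  elim: n => [|n IH] i [[Ai iln] im] //.
  have [iln'|iln'] := ltnP i (s n.+1).2; first exact: IH.
  have [_ _ _ _ /(_ _ _ i)sg] := sP n.+1.
  have Ani : ((A `\` `I_(s n.+1).2) `&` `I_(s n.+2).2) i.
    by split=> //; split=> //=; apply/negP; rewrite -leqNgt.
  have [no|ne] := boolP (odd n); [right|left]; apply: sg => //; rewrite -[next (s n.+1)]/(s n.+2) -s2.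
    have -> : n.+3 = (1 + n./2.*2).+3 by rewrite -[in LHS](odd_double_half n) no.
    exact: yP.
  have -> : n.+3 = (0 + n./2.*2).+3.
    by rewrite -[in LHS](odd_double_half n) (negbTE ne).
  exact: xP.
move=> i [Ai im]; apply: (AS i); split=> //; split=> //=; exact: m_ge.
Qed.

End scheme.

(** * Submeasures from weighted covers *)

(** The values of [phi] on tails decrease, so one small tail makes all later ones small. *)
Lemma exhP (R : realType) (phi : set nat -> \bar R) A : is_submeasure phi ->
  exh phi A <-> forall e : R, (0 < e)%R -> exists m, (phi (A `\` `I_m) < e%:E)%E.
Proof.
move=> [ge0 _ _ le _]; have dec n m : (n <= m)%N ->
    (phi (A `\` `I_m) <= phi (A `\` `I_n))%E.
  by move=> nm; apply: le => i [Ai im]; split=> // /leq_trans/(_ nm).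
split=> [/fine_cvgP[fA /cvgrPdist_lt cA] e e0|small].
  have [m _ mP] := filterI fA (cA _ e0); exists m.+1.
  have [fm] := mP m (leqnn m); rewrite /= sub0r normrN ger0_norm ?fine_ge0 //.
  by rewrite -lte_fin fineK.
have lt_near (e : R) : (0 < e)%R ->
    \forall n \near \oo, (phi (A `\` `I_n.+1) < e%:E)%E.
  move=> /small[m mP]; exists m => // n /= mn; apply: le_lt_trans mP.
  by apply: dec; apply: leqW.
apply/fine_cvgP; split.
  have := lt_near _ ltr01; apply: filterS => n /lt_trans/(_ (ltry _)) lty.
  by rewrite ge0_fin_numE.
apply/cvgrPdist_lt => e /lt_near; apply: filterS => n lte.
rewrite /= sub0r normrN ger0_norm ?fine_ge0 // -lte_fin fineK //.
by rewrite ge0_fin_numE // (lt_trans lte) // ltry.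
Qed.

(* A form of the Birkhoff-Kakutani metrization argument: the weight [2 ^ k] is
   charged for every member of [G k] used in a cover, and a set covered with
   total weight less than [2 ^ k] belongs to [G k]. *)
Section covering_submeasure.
Variables (R : realType) (G : int -> set (set nat)).

Definition weight (l : seq int) : R := (\sum_(k <- l) 2 ^ k)%R.

Fixpoint covers (l : seq int) (A : set nat) : Prop :=
  if l is k :: l' then exists B C, [/\ G k B, covers l' C & A `<=` B `|` C]
  else A `<=` set0.

Definition precovering (A : set nat) : \bar R :=
  ereal_inf [set (weight l)%:E | l in [set l | covers l A]].

(** The supremum over initial segments forces lower semicontinuity. *)
Definition covering (A : set nat) : \bar R :=
  ereal_sup (range (fun n => precovering (A `&` `I_n))).

Lemma weight_cons k l : weight (k :: l) = (2 ^ k + weight l)%R.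
Proof. exact: big_cons. Qed.

Lemma weight_cat l1 l2 : weight (l1 ++ l2) = (weight l1 + weight l2)%R.
Proof. exact: big_cat. Qed.

Lemma weight_ge0 l : (0 <= weight l)%R.
Proof. by apply: sumr_ge0 => k _; apply: exprz_ge0. Qed.

(** The entry [k] is the one at which the partial sums first reach [r]. *)
Lemma weight_split l (r : R) : (0 < r)%R -> (r <= weight l)%R ->
  exists l1 k l2, [/\ l = l1 ++ k :: l2, (weight l1 < r)%R &
    (r <= weight l1 + 2 ^ k)%R].
Proof.
elim: l r => [|k l IH] r r0; first by rewrite /weight big_nil leNgt r0.
rewrite weight_cons => rle; have [rk|kr] := leP r (2 ^ k)%R.
  by exists [::], k, l; split=> //; rewrite /weight big_nil // add0r.
have [||l1 [j [l2 [-> l1r rl1]]]] := IH (r - 2 ^ k)%R; first by rewrite subr_gt0.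
  by rewrite lerBlDl.
exists (k :: l1), j, l2; rewrite weight_cons; split=> //.
  by rewrite addrC -ltrBrDr.
by rewrite -addrA -lerBlDl.
Qed.

Lemma covers_subset l A B : A `<=` B -> covers l B -> covers l A.
Proof.
case: l => [|k l] AB /=; first exact: subset_trans.
by move=> [C [E [? ? BCE]]]; exists C, E; split=> //; exact: subset_trans BCE.
Qed.

Lemma covers_setU l1 l2 A B :
  covers l1 A -> covers l2 B -> covers (l1 ++ l2) (A `|` B).
Proof.
elim: l1 A => [|k l1 IH] A /=.
  by move=> A0; apply: covers_subset => i [/A0|].
move=> [C [E [GC cE ACE]]] cB; exists C, (E `|` B); split=> //.
  exact: IH.
by rewrite setUA; exact: setSU.
Qed.

Lemma covers_cat l1 l2 A : covers (l1 ++ l2) A ->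
  exists B C, [/\ covers l1 B, covers l2 C & A `<=` B `|` C].
Proof.
elim: l1 A => [|k l1 IH] A /=.
  by move=> cA; exists set0, A; split=> //; rewrite set0U.
move=> [B [C [GB /IH[C1 [C2 [cC1 cC2 CC]]] ABC]]].
exists (B `|` C1), C2; split=> //; first by exists B, C1; split.
by rewrite -setUA => i /ABC[?|/CC ?]; [left|right].
Qed.

Hypothesis G_subset : forall k A B, A `<=` B -> G k B -> G k A.
Hypothesis G_closed : forall k A, (forall n, G k (A `&` `I_n)) -> G k A.
Hypothesis G_setU : forall k A B C,
  G k A -> G k B -> G k C -> G (k + 1)%R (A `|` B `|` C).
Hypothesis G0 : forall k, G k set0.
Hypothesis G_bounded : forall n, exists k, G k `I_n.

Lemma G_le j k A : (j <= k)%R -> G j A -> G k A.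
Proof.
move=> jk; have [n ->] : exists n : nat, k = (j + n%:Z)%R.
  have : (0 <= k - j)%R by rewrite subr_ge0.
  by case kj: (k - j)%R => [n|//] _; exists n; rewrite -kj addrC subrK.
move=> GA; elim: n => [|n IH]; first by rewrite addr0.
rewrite -addn1 PoszD addrA -(setUid A) -[X in _ `|` X]setU0.
by rewrite setUA; apply: G_setU.
Qed.

(* Cut the cover into three parts at the place where half of its weight is
   reached. *)
Lemma covers_lt l k A : covers l A -> (weight l < 2 ^ k)%R -> G k A.
Proof.
have [n] := ubnP (size l); elim: n => // n IH in l k A *.
rewrite ltnS => ln cA lk.
have [w0|w0] := eqVneq (weight l) 0%R.
  case: l w0 cA {ln lk} => [_ A0|j l]; first exact: G_subset A0 (G0 k).
  rewrite weight_cons => /eqP; rewrite paddr_eq0 ?weight_ge0 ?exprz_ge0 //.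
  by rewrite gt_eqF ?exprz_gt0.
have {}w0 : (0 < weight l)%R by rewrite lt_def w0 weight_ge0.
have kE : (2 ^ k = 2 ^ (k - 1) * 2 :> R)%R.
  by rewrite -[X in (_ * X)%R]expr1z -expfzDr ?subrK // pnatr_eq0.
have [||l1 [j [l2 [lE l1w wl1]]]] := @weight_split l (weight l / 2)%R.
- by rewrite divr_gt0.
- lra.
move: cA; rewrite lE => /covers_cat[B [C' [cB /= [C [E [GC cE C'E]]] AE]]].
have sz : size l = (size l1 + (size l2).+1)%N by rewrite lE size_cat.
have wE : weight l = (weight l1 + (2 ^ j + weight l2))%R.
  by rewrite lE weight_cat weight_cons.
have w1 := weight_ge0 l1; have w2 := weight_ge0 l2.
(* Both outer parts weigh at most half of [weight l], hence less than [2 ^ (k - 1)]; the middle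
   entry satisfies [2 ^ j < 2 ^ k], hence [j <= k - 1]. *)
rewrite -(subrK 1%R k); apply: (G_subset (B := B `|` C `|` E)).
  by rewrite -setUA => i /AE[?|/C'E ?]; [left|right].
apply: G_setU.
- apply: IH cB _; last by lra.
  by rewrite (leq_trans _ ln) // sz addnS ltnS leq_addr.
- apply: G_le GC; rewrite -ltzD1 subrK.
  rewrite -(@ltr_eXz2l R 2%R) ?ltr1n //; lra.
- apply: IH cE _; last by lra.
  by rewrite (leq_trans _ ln) // sz addnS ltnS leq_addl.
Qed.

Lemma precovering_lt A (r : R) : (precovering A < r%:E)%E ->
  exists2 l, covers l A & (weight l < r)%R.
Proof. by move=> /ereal_inf_lt[_ [l cA <-]]; rewrite lte_fin; exists l. Qed.

Lemma precovering_covers l A : covers l A -> (precovering A <= (weight l)%:E)%E.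
Proof. by move=> cA; apply: ereal_inf_lbound; exists l. Qed.

Lemma precovering_ge0 A : (0 <= precovering A)%E.
Proof.
by apply: le_ereal_inf_tmp => _ [l _ <-]; rewrite lee_fin weight_ge0.
Qed.

Lemma precovering_le A B : A `<=` B -> (precovering A <= precovering B)%E.
Proof.
move=> AB; apply: ereal_inf_le_tmp => _ [l cB <-]; exists l => //.
exact: covers_subset cB.
Qed.

Lemma precoveringU A B :
  (precovering (A `|` B) <= precovering A + precovering B)%E.
Proof.
have [Aoo|Aoo] := eqVneq (precovering A) +oo%E.
  rewrite Aoo addye ?leey // gt_eqF //.
  by rewrite (lt_le_trans _ (precovering_ge0 B)) ?ltNye.
have [Boo|Boo] := eqVneq (precovering B) +oo%E.
  rewrite Boo addey ?leey // gt_eqF //.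
  by rewrite (lt_le_trans _ (precovering_ge0 A)) ?ltNye.
have fA : precovering A \is a fin_num.
  by rewrite ge0_fin_numE ?precovering_ge0 // ltey.
have fB : precovering B \is a fin_num.
  by rewrite ge0_fin_numE ?precovering_ge0 // ltey.
apply/lee_addgt0Pr => e e0.
have e2 : (0 < e / 2)%R by rewrite divr_gt0.
have [|l1 c1 w1] := @precovering_lt A (fine (precovering A) + e / 2)%R.
  by rewrite EFinD fineK // lteDl.
have [|l2 c2 w2] := @precovering_lt B (fine (precovering B) + e / 2)%R.
  by rewrite EFinD fineK // lteDl.
apply: le_trans (precovering_covers (covers_setU c1 c2)) _.
rewrite -(fineK fA) -(fineK fB) -!EFinD lee_fin weight_cat; lra.
Qed.

Lemma covering_lt k A : (covering A < (2 ^ k)%:E)%E -> G k A.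
Proof.
move=> Ak; apply: G_closed => n.
have /precovering_lt[l cA lw] : (precovering (A `&` `I_n) < (2 ^ k)%:E)%E.
  by apply: le_lt_trans Ak; apply: ereal_sup_ubound; exists n.
exact: covers_lt lw.
Qed.

Lemma covering_le k A : G k A -> (covering A <= (2 ^ k)%:E)%E.
Proof.
move=> GA; apply: ge_ereal_sup => _ [n _ <-].
have -> : (2 ^ k)%R = weight [:: k] by rewrite /weight big_seq1.
apply: precovering_covers; exists A, set0; split=> //.
by rewrite setU0; exact: subIsetl.
Qed.

Lemma covering_lsc_submeasure : lsc_submeasure covering.
Proof.
have le A B : A `<=` B -> (covering A <= covering B)%E.
  move=> AB; apply: ge_ereal_sup => _ [n _ <-].
  apply: (@le_trans _ _ (precovering (B `&` `I_n))).
    by apply: precovering_le; exact: setSI.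
  by apply: ereal_sup_ubound; exists n.
have ge0 A : (0 <= covering A)%E.
  apply: le_trans (precovering_ge0 (A `&` `I_0)) _.
  by apply: ereal_sup_ubound; exists 0%N.
split; first split=> //.
- apply/eqP; rewrite eq_le ge0 andbT; apply: ge_ereal_sup => _ [n _ <-].
  have -> : 0%E = (weight [::])%:E by rewrite /weight big_nil.
  by apply: precovering_covers; rewrite set0I.
- move=> n; have [k Gk] := G_bounded n.+1.
  apply: le_lt_trans (ltry (2 ^ k)%R); apply: covering_le.
  by apply: G_subset Gk => _ ->/=.
- move=> A B; apply: ge_ereal_sup => _ [n _ <-]; rewrite setIUl.
  apply: le_trans (precoveringU _ _) _.
  by apply: leeD; apply: ereal_sup_ubound; exists n.
(* On initial segments [covering] and [precovering] agree, so the claim is convergence of a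
   nondecreasing sequence to its supremum. *)
- move=> A; have -> : (fun n => covering (A `&` `I_n.+1)) =
      (fun n => precovering (A `&` `I_n.+1)).
    apply/funext => n; apply/eqP; rewrite eq_le; apply/andP; split.
      apply: ge_ereal_sup => _ [m _ <-]; apply: precovering_le.
      exact: subIsetl.
    by apply: ereal_sup_ubound; exists n.+1 => //; rewrite -setIA setIid.
  rewrite (@cvg_shiftS _ (fun n => precovering (A `&` `I_n))).
  apply: ereal_nondecreasing_cvgn => n m nm; apply: precovering_le.
  by apply: setIS => i /= /leq_trans; apply.
Qed.

Lemma covering_exhP A :
  exh covering A <-> forall k, exists m, G k (A `\` `I_m).
Proof.
have [sub _] := covering_lsc_submeasure; rewrite (exhP A sub); split.
  move=> sA k; have [|m mP] := sA (2 ^ k)%R; first by rewrite exprz_gt0.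
  by exists m; exact: covering_lt.
move=> GA e e0; have [n _ /(_ n (leqnn n)) ne] :=
  near_infty_natSinv_expn_lt (PosNum e0).
have [m mP] := GA (- n%:Z)%R; exists m.
apply: le_lt_trans (covering_le mP) _; rewrite lte_fin.
by move: ne; rewrite div1r /= -exprnN.
Qed.

End covering_submeasure.

(** * Solecki's theorem relative to a submeasure *)

Lemma large_family_setT I : large_family I setT.
Proof. by split=> // A _; exists 0. Qed.

Lemma large_family_set0 I F : is_ideal I -> large_family I F -> F set0.
Proof.
move=> idI lF; have [m] := large_tail lF (ideal_finite idI (finite_set0 _)).
by rewrite set0D.
Qed.

Lemma cylinder_family_agree g D k x y : agree k x y ->
  cylinder_family g D x k = cylinder_family g D y k.
Proof.
by move=> xy; apply/seteqP; split=> A FA n; have [z [Dz az Az]] := FA n;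
  exists z; split=> //; apply: agree_trans az => //; exact: agree_sym.
Qed.

(** Cylinders are coded by finite sequences. Codes of cylinders that miss [D] receive the default
    [setT], which is large. *)
Lemma cylinder_family_enum I g D : cofinal_scheme I g D ->
  exists2 F : nat -> set (set nat), (forall n, large_family I (F n)) &
    forall x k, D x -> exists n, F n = cylinder_family g D x k.
Proof.
move=> sD.
have /choice[F FP] : forall n, exists F, large_family I F /\
    forall s, unpickle n = Some s ->
      forall x, D x -> agree (size s) (nth 0 s) x ->
      F = cylinder_family g D x (size s).
  move=> n; case: (unpickle n) => [s|]; last first.
    by exists setT; split=> //; exact: large_family_setT.
  have [[x [Dx sx]]|nx] := pselect (exists x, D x /\ agree (size s) (nth 0 s) x).
    exists (cylinder_family g D x (size s)); split.
      exact: cylinder_family_large.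
    move=> _ [<-] y Dy sy; apply: cylinder_family_agree.
    by apply: agree_trans sy; exact: agree_sym.
  exists setT; split; first exact: large_family_setT.
  by move=> _ [<-] x Dx sx; case: nx; exists x.
exists F => [n|x k Dx]; first by have [] := FP n.
have [_ /(_ (mkseq x k) _ x Dx)] := FP (pickle (mkseq x k)).
rewrite pickleK size_mkseq => FE; exists (pickle (mkseq x k)).
by apply: FE => // i ik; rewrite nth_mkseq.
Qed.

Lemma large_chain I F0 (F : nat -> set (set nat)) g D :
  is_ideal I -> cofinal_scheme I g D ->
  large_family I F0 -> (forall n, large_family I (F n)) ->
  exists H : nat -> set (set nat), [/\ H 0 = F0,
    forall n, large_family I (H n), forall n, H n.+1 `<=` F n &
    forall n A B C, H n.+1 A -> H n.+1 B -> H n.+1 C -> H n (A `|` B `|` C)].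
Proof.
move=> idI sD lF0 lF.
have /choice[step stepP] : forall nE : nat * set (set nat), exists E',
    large_family I nE.2 -> [/\ large_family I E', E' `<=` F nE.1 &
      forall A B C, E' A -> E' B -> E' C -> nE.2 (A `|` B `|` C)].
  move=> [n E] /=; have [lE|nE] := pselect (large_family I E); last by exists E.
  have [E' lE' E'P] := large_family_third sD idI (large_familyI lE (lF n)).
  exists E' => _; split=> // [A E'A|A B C *]; last first.
    by have [] := E'P A B C.
  (* Three equal members show that [E'] lies in the family it was obtained from, hence in [F n]. *)
  by have [] := E'P A A A E'A E'A E'A; rewrite !setUid.
pose H := fix H n := if n is m.+1 then step (m, H m) else F0.
have lH n : large_family I (H n).
  by elim: n => // n IH; have [] := stepP (n, H n) IH.
by exists H; split=> // n; have [] := stepP (n, H n) (lH n).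
Qed.

Lemma lsc_sublevel (R : realType) (phi : set nat -> \bar R) A (c : \bar R) :
  lsc phi -> (forall n, phi (A `&` `I_n) <= c)%E -> (phi A <= c)%E.
Proof.
move=> /(_ A) cA Ac; rewrite -(cvg_lim (@ereal_hausdorff R) cA).
by apply: lime_le; [apply/cvg_ex; exists (phi A) | exact: nearW].
Qed.

(** Otherwise each [N] has a set in [I] all of whose tails exceed [N.+1]. A pseudo-union [B]
    contains such a tail for every [N], contradicting finiteness of [phi B]. *)
Lemma large_sublevel (R : realType) (phi : set nat -> \bar R) I :
  P_ideal I -> lsc_submeasure phi -> I `<=` fin phi ->
  exists N, large_family I [set A | phi A <= (N.+1%:R)%:E]%E.
Proof.
move=> PI [[ge0 _ _ le _] lphi] Ifin; apply: contrapT => /forallNP nl.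
have /choice[A AP] : forall N, exists A, I A /\
    forall m, ((N.+1%:R)%:E < phi (A `\` `I_m))%E.
  move=> N; apply: contrapT => /forallNP nA; apply: (nl N); split.
  - by move=> A B AB /=; apply: le_trans; exact: le.
  - by move=> A FA; exact: lsc_sublevel.
  - move=> A IA; apply: contrapT => /forallNP nm; apply: (nA A); split=> // m.
    by rewrite ltNge; apply/negP/nm.
have [B IB AB] := PI A (fun N => (AP N).1).
have fB : phi B \is a fin_num by rewrite ge0_fin_numE //; exact: Ifin.
have [m ABm] := finite_set_bounded (AB (Num.truncn (fine (phi B)))).
have := (AP (Num.truncn (fine (phi B)))).2 m; apply/negP; rewrite -leNgt.
apply: (@le_trans _ _ (phi B)).
  apply: le => i [Ai im]; apply: contrapT => nB; apply: im; apply: ABm.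
  by split.
by rewrite -[leLHS]fineK // lee_fin ltW // truncnS_gt.
Qed.

Lemma submeasure_segment_lty (R : realType) (phi : set nat -> \bar R) n :
  is_submeasure phi -> (phi `I_n < +oo)%E.
Proof.
move=> [ge0 phi0 phi1 le leU]; elim: n => [|n IH]; first by rewrite II0 phi0.
by rewrite IIS; apply: le_lt_trans (leU _ _) _; apply: lte_add_pinfty.
Qed.

(* Solecki's theorem, with control on [fin chi]; taking [phi = 0] gives back
   the theorem itself. *)
Lemma analytic_P_ideal_exh (R : realType) (phi : set nat -> \bar R) I :
  is_ideal I -> analytic_ideal I -> P_ideal I ->
  lsc_submeasure phi -> I `<=` fin phi ->
  exists chi : set nat -> \bar R,
    [/\ lsc_submeasure chi, I = exh chi & fin chi `<=` fin phi].
Proof.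
move=> idI anI PI lphi Ifin.
have [g [D sD]] := analytic_P_ideal_scheme idI anI PI.
have [N lN] := large_sublevel PI lphi Ifin.
have [F lF FP] := cylinder_family_enum sD.
have [H [H0 lH HF HU]] := large_chain idI sD lN lF.
(* The factor 3 matches subadditivity for three sets. [Negz n] is [- n.+1], so the chain [H]
   continues downwards from [H 0], which is [G 0]. *)
pose G (k : int) := match k with
  | Posz n => [set A | phi A <= (3 ^+ n * N.+1%:R)%:E]%E
  | Negz n => H n.+1 end.
have [[ge0 phi0 phi1 le leU] lscphi] := lphi.
have G_subset k A B : A `<=` B -> G k B -> G k A.
  case: k => n AB /=; first by apply: le_trans; exact: le.
  exact: (large_subset (lH n.+1)).
have G_closed k A : (forall n, G k (A `&` `I_n)) -> G k A.
  case: k => n GA /=; first exact: lsc_sublevel.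
  exact: (large_closed (lH n.+1)).
have G_setU k A B C : G k A -> G k B -> G k C -> G (k + 1)%R (A `|` B `|` C).
  case: k => [n|[|n]] GA GB GC.
  - rewrite -PoszD addn1 /= exprS -mulrA.
    set c := (3 ^+ n * N.+1%:R)%R.
    have -> : (3 * c)%:E = (c%:E + c%:E + c%:E)%E.
      by rewrite -!EFinD; congr EFin; lra.
    apply: le_trans (leU _ _) _; apply: leeD => //.
    by apply: le_trans (leU _ _) _; apply: leeD.
  - by have := HU 0 A B C GA GB GC; rewrite H0 /= mul1r.
  - have -> : (Negz n.+1 + 1 = Negz n)%R.
      by rewrite !NegzE -[in LHS]addn1 PoszD opprD addrK.
    exact: HU GA GB GC.
have G0 k : G k set0.
  case: k => n /=; first by rewrite phi0 lee_fin mulr_ge0 ?exprn_ge0.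
  exact: large_family_set0 (lH n.+1).
have G_bounded n : exists k, G k `I_n.
  have fn : phi `I_n \is a fin_num.
    by rewrite ge0_fin_numE //; apply: submeasure_segment_lty; case: lphi.
  exists (Posz (Num.truncn (fine (phi `I_n))).+1) => /=.
  rewrite -(fineK fn) lee_fin /=; set t := Num.truncn _.
  apply: (@le_trans _ _ (t.+1%:R)%R); first by rewrite ltW // truncnS_gt.
  rewrite -natrX -natrM ler_nat.
  by rewrite (leq_trans (ltnW (ltn_expl t.+1 (isT : 1 < 3)))) // leq_pmulr.
exists (covering R G); split.
- exact: covering_lsc_submeasure.
- apply/seteqP; split=> A;
    rewrite (covering_exhP R G_subset G_closed G_setU G0 G_bounded).
    move=> IA; case=> n /=; last exact: (large_tail (lH n.+1) IA).
    have [m mP] := large_tail lN IA; exists m; apply: le_trans mP _.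
    by rewrite lee_fin ler_peMl // exprn_ege1 // ler1n.
  (* Each cylinder family is some [F n], which contains [H n.+1], that is [G (Negz n)]. *)
  move=> GA; apply: (cylinder_families_ideal sD idI) => x k /(FP _ k)[n <-].
  by have [m mP] := GA (Negz n); exists m; apply: HF.
- move=> A fA.
  have cA : covering R G A \is a fin_num.
    rewrite ge0_fin_numE //.
    have [sub _] := covering_lsc_submeasure R G_subset G_bounded.
    exact: submeasure_ge0 sub A.
  (* A finite value of [covering] lies below some [2 ^ k] with [k] natural, which places [A] in a
     sublevel set of [phi]. *)
  have : G (Posz (Num.truncn (fine (covering R G A))).+1) A.
    apply: (covering_lt (R := R) G_subset G_closed G_setU G0).
    rewrite -[X in (X < _)%E](fineK cA) lte_fin; set t := Num.truncn _.
    apply: (@lt_trans _ _ (t.+1%:R)%R); first by rewrite truncnS_gt.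
    by rewrite -exprnP -natrX ltr_nat ltn_expl.
  by rewrite /fin /= => /le_lt_trans; apply; exact: ltry.
Qed.

(** A set splits into a finite segment and a tail of value less than 1. *)
Lemma exh_sub_fin (R : realType) (phi : set nat -> \bar R) :
  is_submeasure phi -> exh phi `<=` fin phi.
Proof.
move=> sphi A /(exhP A sphi)/(_ 1%R ltr01)[m mP].
apply: (@le_lt_trans _ _ (phi `I_m + phi (A `\` `I_m))%E).
  apply: le_trans (submeasureU sphi _ _); apply: (submeasure_le sphi) => i Ai.
  by have [?|?] := pselect (`I_m i); [left|right].
apply: lte_add_pinfty; first exact: submeasure_segment_lty.
exact: lt_trans mP (ltry _).
Qed.

Theorem theorem6p9 (R : realType) (I : set (set nat)) (idealI : is_ideal I)
  (analyticI : analytic_ideal I) (PI : P_ideal I) :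
  totally_bounded R I <-> local_to_global_boundedness R I.
Proof.
split=> [tbI phi lphi Ifin | lgI phi lphi IE].
  have [chi [lchi IE]] := analytic_P_ideal_exh idealI analyticI PI lphi Ifin.
  by apply; exact: tbI.
by apply: lgI => //; rewrite IE; apply: exh_sub_fin; case: lphi.
Qed.
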